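(* Let $G$ be a compact topological group and let $G_0$ be the connected component of $G$ containing the identity element. Every finite-dimensional real continuous $G$-representation that is admissible for non-affine activation functions is $G_0$-invariant, i.e. every element of $G_0$ acts on it as the identity. In particular, if $G$ is connected, every such admissible $G$-representation is trivial, i.e. every element of $G$ acts as the identity.
   Context: For a finite-dimensional real vector space $V$ with a basis $\mathcal B=\{v_1,\dots,v_d\}$ and a continuous function $f:\mathbb R\to\mathbb R$, the point-wise activation induced by $f$ on $\mathcal B$ is $\tilde f(a_1v_1+\cdots+a_dv_d)=f(a_1)v_1+\cdots+f(a_d)v_d$. A $G$-representation $V$ is admissible for non-affine activation functions if there are a basis $\mathcal B$ of $V$ and a continuous function $f:\mathbb R\to\mathbb R$ that is not affine (not of the form $x\mapsto ax+c$) such that $\tilde f$ is $G$-equivariant, i.e. $\tilde f(gv)=g\tilde f(v)$ for all $g\in G$, $v\in V$. *)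

(* Defs.v *)
From HB Require Import structures.
From mathcomp Require Import all_boot all_order all_algebra.
From mathcomp Require Import all_classical all_reals all_analysis.

Set Implicit Arguments.
Unset Strict Implicit.
Unset Printing Implicit Defensive.

Import Order.TTheory GRing.Theory Num.Theory.
Import numFieldNormedType.Exports.

Local Open Scope classical_set_scope.
Local Open Scope ring_scope.

(* No separation axiom is imposed. *)
HB.mixin Record Topological_Group_isTopologicalGroup G
    & Topological G & Group G := {
  mulg_continuous : continuous (fun p : G * G => (p.1 * p.2)%g) ;
  invg_continuous : continuous (fun x : G => (x^-1)%g)
}.

#[short(type="topologicalGroupType")]
HB.structure Definition TopologicalGroup :=
  {G of Topological G & Group G & Topological_Group_isTopologicalGroup G}.

(* A vectType carries no topology. This is V with the usual topology of a
   finite-dimensional real vector space, transported from R^n by coordinates in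
   the library's default basis; the choice of basis is immaterial, since every
   linear automorphism of R^n is a homeomorphism. *)
Definition vcoord (R : realType) (V : vectType R) (v : V) : 'rV[R]_(\dim {:V}) :=
  \row_i coord (vbasis {:V}) i v.

Definition euclidean (R : realType) (V : vectType R) : Type :=
  initial_topology (@vcoord R V).

HB.instance Definition _ (R : realType) (V : vectType R) :=
  Topological.copy (euclidean V) (initial_topology (@vcoord R V)).

Record is_continuous_representation (R : realType) (G : topologicalGroupType)
    (V : vectType R) (rho : G -> 'End(V)) : Prop := {
  rep1 : rho 1%g = \1%VF ;
  repM : forall g h : G, rho (g * h)%g = (rho g \o rho h)%VF ;
  rep_continuous : continuous
    (fun p : G * euclidean V => rho p.1 (p.2 : V) : euclidean V)
}.

Definition affine_function (R : realType) (f : R -> R) : Prop :=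
  exists a c : R, forall x : R, f x = a * x + c.

(* Only meaningful when B is a basis of V. *)
Definition pointwise_activation (R : realType) (V : vectType R) (d : nat)
    (B : d.-tuple V) (f : R -> R) (v : V) : V :=
  \sum_(i < d) f (coord B i v) *: B`_i.

Definition equivariant (R : realType) (G : topologicalGroupType)
    (V : vectType R) (rho : G -> 'End(V)) (F : V -> V) : Prop :=
  forall (g : G) (v : V), F (rho g v) = rho g (F v).

Definition admissible (R : realType) (G : topologicalGroupType)
    (V : vectType R) (rho : G -> 'End(V)) : Prop :=
  exists (d : nat) (B : d.-tuple V) (f : R -> R),
    [/\ basis_of fullv B, continuous f, ~ affine_function f &
        equivariant rho (pointwise_activation B f)].

Definition identity_component (G : topologicalGroupType) : set G :=
  connected_component [set: G] 1%g.
Arguments identity_component : clear implicits.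

Definition acts_trivially (R : realType) (G : topologicalGroupType)
    (V : vectType R) (rho : G -> 'End(V)) (H : set G) : Prop :=
  forall g : G, H g -> forall v : V, rho g v = v.

(* Main.v *)
(* If a row (a_j) of the matrix of rho g in the basis B had two nonzero entries,
   then f (\sum_j a_j x_j) = \sum_j a_j f (x_j) would make f - f 0 additive,
   hence linear by continuity, and f affine. So the matrices are monomial; the
   positivity of a diagonal entry is then both an open and a closed condition on
   g, hence it holds on the identity component. There the matrices are diagonal
   with positive entries, and their powers are bounded by compactness of G, as
   are those of their inverses: the entries are 1. *)
From HB Require Import structures.
Require Import Defs.
From mathcomp Require Import all_boot all_order all_algebra.
From mathcomp Require Import all_classical all_reals all_analysis ring lra.

Set Implicit Arguments.
Unset Strict Implicit.
Unset Printing Implicit Defensive.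

Import Order.TTheory GRing.Theory Num.Theory.
Import numFieldNormedType.Exports.

Local Open Scope classical_set_scope.
Local Open Scope ring_scope.

(** Additivity and [h 1 = 0] force [h] to vanish on the rationals; the open set where [h] is nonzero
    would, if inhabited, contain one of them by density. *)
Lemma additive_continuous_eq0 (R : realType) (h : R -> R) :
  continuous h -> {morph h : x y / x - y} -> h 1 = 0 -> forall x, h x = 0.
Proof.
move=> ch hB h1 x; apply: contrapT => /eqP hx0.
pose hM := GRing.isZmodMorphism.Build R R h hB.
pose ha : {additive R -> R} := HB.pack h hM.
have hq (q : rat) : h (ratr q) = 0.
  have dq0 : (denq q)%:~R != 0 :> R by rewrite intr_eq0 denq_neq0.
  have : ha (ratr q *~ denq q) = ha (1 *~ numq q).
    by rewrite -mulrzr /ratr divfK.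
  rewrite !raddfMz /= h1 mul0rz -mulrzr => /eqP.
  by rewrite mulf_eq0 (negbTE dq0) orbF => /eqP.
have [||y [/= hy [q _ qy]]] := @dense_rat R (h @^-1` [set~ 0]).
- by exists x; apply/eqP.
- apply: open_comp; first by move=> y _; exact: ch.
  by apply: closed_openC; exact: closed_eq.
- by apply: hy; rewrite -qy hq.
Qed.

Lemma affine_of_two_coeffs (R : realType) (f : R -> R) (a b c : R) :
  continuous f -> a != 0 -> b != 0 ->
  (forall x y, f (a * x + b * y) = a * f x + b * f y + c) ->
  affine_function f.
Proof.
move=> cf a0 b0 fab.
have fD u v : f (u + v) = f u + f v - f 0.
  (* [P] separates the variables; its instances at [(u, v)], [(u, 0)], [(0, v)] and [(0, 0)]
     eliminate [a], [b] and [c]. *)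
  have P s t : f (s + t) = a * f (s / a) + b * f (t / b) + c.
    by rewrite -fab !(mulrC _ (_ / _)) !divfK.
  have := P u 0; have := P 0 v; have := P 0 0.
  have := P u v.
  by rewrite !mul0r !addr0 !add0r; lra.
(* Subtracting the chord through 0 and 1 leaves an additive function that vanishes at 1. *)
pose h x := f x - f 0 - (f 1 - f 0) * x.
have h0 : forall x, h x = 0.
  apply: additive_continuous_eq0.
  - move=> x; apply: cvgB; first by apply: cvgB; [exact: cf|exact: cvg_cst].
    by apply: cvgM; [exact: cvg_cst|exact: cvg_id].
  - move=> x y; rewrite /h.
    have := fD (x - y) y; rewrite subrK => ->.
    by ring.
  - by rewrite /h; ring.
exists (f 1 - f 0), (f 0) => x.
by have /eqP := h0 x; rewrite /h -addrA -opprD subr_eq0 addrC => /eqP.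
Qed.

Lemma nonaffine_single_coeff (R : realType) (d : nat) (f : R -> R)
    (a : 'I_d -> R) (j k : 'I_d) :
  continuous f -> ~ affine_function f ->
  (forall x : 'I_d -> R, f (\sum_i x i * a i) = \sum_i f (x i) * a i) ->
  j != k -> a j != 0 -> a k = 0.
Proof.
move=> cf naf fa jk aj; apply: contra_notP naf => /eqP ak.
(* The variables other than the [j]-th and [k]-th are set to 0; as [f 0] may be nonzero, they still
   contribute this constant. *)
apply: (affine_of_two_coeffs (c := \sum_(i | (i != j) && (i != k)) f 0 * a i)
  cf aj ak) => x y.
have kj : k != j by rewrite eq_sym.
have split2 (F : 'I_d -> R) :
    \sum_i F i = F j + (F k + \sum_(i | (i != j) && (i != k)) F i).
  by rewrite (bigD1 j) //= (bigD1 k).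
have := fa (fun i => if i == j then x else if i == k then y else 0).
rewrite !split2 !eqxx (negbTE kj) big1 => [|i /andP[/negbTE -> /negbTE ->]]; last first.
  by rewrite mul0r.
rewrite addr0 (mulrC x) (mulrC y) => ->.
rewrite !(mulrC (f _)) addrA; congr (_ + _).
by apply: eq_bigr => i /andP[/negbTE -> /negbTE ->]; rewrite mulrC.
Qed.

Lemma connected_sub_clopen (T : topologicalType) (A U : set T) (x : T) :
  connected A -> open U -> closed U -> A x -> U x -> A `<=` U.
Proof.
move=> cA oU clU Ax Ux.
suff <- : A `&` U = A by move=> y [].
by apply: cA; [exists x | exists U | exists U].
Qed.

(** If [|a| > 1], then [C / |a| ^ n] tends to 0 and drops below 1, so some power of [a] exceeds
    [C]. *)
Lemma power_bounded (R : realType) (a C : R) :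
  (forall n, `|a ^+ n| <= C) -> `|a| <= 1.
Proof.
move=> aC; rewrite leNgt; apply/negP => a1.
have a0 : 0 < `|a| by rewrite (lt_trans ltr01).
have : (C * (`|a|^-1) ^+ n) @[n --> \oo] --> C * 0.
  apply: cvgM; first exact: cvg_cst.
  by apply: cvg_expr; rewrite normfV normr_id invf_lt1.
rewrite mulr0 => /cvgr_lt /(_ _ ltr01)[n _ /(_ n (leqnn n))] /=.
by rewrite exprVn ltr_pdivrMr ?exprn_gt0 // mul1r -normrX ltNge aC.
Qed.

Section MatrixEntries.
Variables (R : realType) (G : topologicalGroupType) (V : vectType R).
Variables (rho : G -> 'End(V)) (d : nat) (B : d.-tuple V).
Hypothesis rhoP : is_continuous_representation rho.
Hypothesis basisB : basis_of fullv B.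

Definition rep_entry (i j : 'I_d) (g : G) : R := coord B i (rho g B`_j).

Lemma coord_rep (g : G) (i : 'I_d) (v : V) :
  coord B i (rho g v) = \sum_j coord B j v * rep_entry i j g.
Proof.
rewrite {1}(coord_basis basisB (memvf v)) !linear_sum /=.
by apply: eq_bigr => j _; rewrite !linearZ.
Qed.

Lemma rep_entry1 (i j : 'I_d) : rep_entry i j 1%g = (i == j)%:R.
Proof.
by rewrite /rep_entry (rep1 rhoP) id_lfunE coord_free ?(basis_free basisB) // eq_sym.
Qed.

Lemma rep_entryM (i j : 'I_d) (g h : G) :
  rep_entry i j (g * h)%g = \sum_k rep_entry k j h * rep_entry i k g.
Proof. by rewrite {1}/rep_entry (repM rhoP) lfunE /= coord_rep. Qed.

(** The topology comes from [vbasis], whereas [B] is the basis of the activation: a coordinate in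
    [B] is a fixed linear combination of the coordinates in [vbasis]. *)
Lemma coord_euclidean_continuous (i : 'I_d) :
  continuous (coord B i : euclidean V -> R).
Proof.
have -> : (coord B i : euclidean V -> R) =
  (fun v : euclidean V => \sum_k vcoord (v : V) 0 k * coord B i (vbasis {:V})`_k).
  apply/funext => v; rewrite {1}(coord_vbasis (memvf (v : V))) linear_sum /=.
  by apply: eq_bigr => k _; rewrite linearZ mxE.
apply: continuous_big => [|k _ v]; first exact: add_continuous.
apply: (@cvgM _ _ _ (nbhs_filter (v : euclidean V))); last exact: cvg_cst.
apply: (@continuous_comp (euclidean V) _ _ (@vcoord R V) (fun r => r 0 k)).
  exact: initial_continuous.
exact: coord_continuous.
Qed.

Lemma rep_entry_continuous (i j : 'I_d) : continuous (rep_entry i j).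
Proof.
move=> g.
have pair_cont : continuous (fun h : G => (h, B`_j) : G * euclidean V).
  move=> h; apply: (@cvg_pair _ _ (euclidean V) _ _ _
    (nbhs_filter h) (nbhs_filter h) (nbhs_filter _)); first exact: cvg_id.
  exact: cvg_cst.
apply: (@continuous_comp G (euclidean V) R
  (fun h => rho h B`_j : euclidean V) (coord B i)).
  exact: (continuous_comp (pair_cont g) (@rep_continuous _ _ _ _ rhoP _)).
exact: coord_euclidean_continuous.
Qed.

Lemma rep_entry_bounded (i j : 'I_d) :
  compact [set: G] -> exists C, forall g, `|rep_entry i j g| <= C.
Proof.
move=> cG.
have : compact (rep_entry i j @` [set: G]).
  apply: continuous_compact => //.
  exact/continuous_subspaceT/rep_entry_continuous.
move=> /compact_bounded[M [_ MC]].
(* [MC] only gives bounds strictly larger than [M]. *)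
exists (M + 1) => g; apply: (MC (M + 1)); first by rewrite ltrDl.
by exists g.
Qed.

Variable f : R -> R.
Hypothesis cf : continuous f.
Hypothesis naf : ~ affine_function f.
Hypothesis eqf : equivariant rho (pointwise_activation B f).

Lemma rep_row_equivariant (i : 'I_d) (g : G) (x : 'I_d -> R) :
  f (\sum_j x j * rep_entry i j g) = \sum_j f (x j) * rep_entry i j g.
Proof.
have freeB := basis_free basisB.
have := congr1 (coord B i) (eqf g (\sum_j x j *: B`_j)).
rewrite /pointwise_activation coord_sum_free // !coord_rep.
under eq_bigr do rewrite coord_sum_free //.
by under [RHS]eq_bigr do rewrite !coord_sum_free //.
Qed.

Lemma rep_row_single (i j k : 'I_d) (g : G) :
  j != k -> rep_entry i j g != 0 -> rep_entry i k g = 0.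
Proof.
exact: (nonaffine_single_coeff (a := rep_entry i ^~ g) cf naf
  (rep_row_equivariant i g)).
Qed.

(** A zero row of [rho g] would make the [i]-th diagonal entry of [rho (g * g^-1)] equal to 0
    instead of 1. *)
Lemma rep_row_neq0 (i : 'I_d) (g : G) : exists j, rep_entry i j g != 0.
Proof.
apply: contrapT => /forallNP row0.
have := rep_entryM i i g g^-1%g.
rewrite mulgV rep_entry1 eqxx big1 => [/eqP|j _]; first by rewrite oner_eq0.
by have /negP/negPn/eqP -> := row0 j; rewrite mulr0.
Qed.

(** Row [i] of [rho g] is zero off the diagonal, so a single term of the matrix product survives. *)
Lemma rep_diagM (i : 'I_d) (g h : G) : rep_entry i i g != 0 ->
  rep_entry i i (g * h)%g = rep_entry i i g * rep_entry i i h.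
Proof.
move=> gi; rewrite rep_entryM (bigD1 i) //= big1 ?addr0 1?mulrC // => k ki.
by rewrite (rep_row_single _ gi) ?mulr0 // eq_sym.
Qed.

Lemma rep_diagX (i : 'I_d) (g : G) (n : nat) : rep_entry i i g != 0 ->
  rep_entry i i (g ^+ n)%g = rep_entry i i g ^+ n.
Proof.
move=> gi; elim: n => [|n IHn]; first by rewrite expg0 rep_entry1 eqxx.
by rewrite expgS rep_diagM // IHn exprS.
Qed.

Lemma rep_diag_norm (i : 'I_d) (g : G) : compact [set: G] ->
  rep_entry i i g != 0 -> `|rep_entry i i g| = 1.
Proof.
move=> /(rep_entry_bounded i i)[C hC].
(* The bound [C] is uniform on [G], so it covers all powers of [h]; this is applied to both [g] and
   its inverse, whose diagonal entries have product 1. *)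
have le1 h : rep_entry i i h != 0 -> `|rep_entry i i h| <= 1.
  by move=> hi; apply: (@power_bounded _ _ C) => n; rewrite -rep_diagX.
move=> gi; apply/eqP; rewrite eq_le le1 //=.
have gV : rep_entry i i g * rep_entry i i g^-1%g = 1.
  by rewrite -rep_diagM // mulgV rep_entry1 eqxx.
have gVi : rep_entry i i g^-1%g != 0.
  by apply/eqP => g0; move: gV; rewrite g0 mulr0 => /eqP; rewrite eq_sym oner_eq0.
by rewrite -[leLHS]normr1 -gV normrM ler_piMr // le1.
Qed.

Lemma rep_diag_gt0_open (i : 'I_d) : open [set g | 0 < rep_entry i i g].
Proof.
apply: (@open_comp _ _ (rep_entry i i) [set x | 0 < x]); last exact: open_gt.
by move=> g _; exact: rep_entry_continuous.
Qed.

(* As every row has exactly one nonzero entry, the open condition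
   [rep_entry i i g != 0] is equivalent to the vanishing of the other entries
   of the row, which is closed. *)
Lemma rep_diag_gt0_closed (i : 'I_d) : closed [set g | 0 < rep_entry i i g].
Proof.
have -> : [set g | 0 < rep_entry i i g] =
    [set g | 0 <= rep_entry i i g] `&`
    \bigcap_(j in [set j | j != i]) [set g | rep_entry i j g = 0].
  apply/seteqP; split=> g /= [].
    move=> gi; split; first exact: ltW.
    by move=> j /= ji; apply: (@rep_row_single i i); [rewrite eq_sym|rewrite gt_eqF].
  move=> gi g0; rewrite lt_neqAle gi andbT eq_sym.
  have [j gj] := rep_row_neq0 i g.
  have [ji|ji] := eqVneq j i; first by rewrite ji in gj.
  by rewrite (g0 j ji) eqxx in gj.
apply: closedI.
  apply: (@closed_comp _ _ (rep_entry i i) [set x | 0 <= x]); last exact: closed_ge.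
  by move=> g _; exact: rep_entry_continuous.
apply: closed_bigI => j _.
apply: (@closed_comp _ _ (rep_entry i j) [set x | x = 0]); last exact: closed_eq.
by move=> g _; exact: rep_entry_continuous.
Qed.

Lemma rep_identity_component_trivial :
  compact [set: G] -> acts_trivially rho (identity_component G).
Proof.
move=> cG g G0g v.
have pos i : 0 < rep_entry i i g.
  suff: identity_component G `<=` [set h | 0 < rep_entry i i h] by exact.
  apply: (connected_sub_clopen (x := 1%g)).
  - exact: component_connected.
  - exact: rep_diag_gt0_open.
  - exact: rep_diag_gt0_closed.
  - exact: connected_component_refl.
  - by rewrite /= rep_entry1 eqxx.
have diag1 i : rep_entry i i g = 1.
  by rewrite -(gtr0_norm (pos i)) rep_diag_norm // gt_eqF.
(* Since each diagonal entry is 1, hence nonzero, it is the only nonzero entry of its row. *)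
rewrite (coord_basis basisB (memvf (rho g v))) [RHS](coord_basis basisB (memvf v)).
apply: eq_bigr => i _; congr (_ *: _); rewrite coord_rep (bigD1 i) //= diag1.
rewrite mulr1 big1 ?addr0 // => j ji.
have ij : i != j by rewrite eq_sym.
by rewrite (rep_row_single ij) ?mulr0 // diag1 oner_eq0.
Qed.

End MatrixEntries.

Theorem corollary3 (R : realType) (G : topologicalGroupType)
    (G_compact : compact [set: G]) :
  (forall (V : vectType R) (rho : G -> 'End(V)),
     is_continuous_representation rho -> admissible rho ->
     acts_trivially rho (identity_component G)) /\
  (connected [set: G] ->
   forall (V : vectType R) (rho : G -> 'End(V)),
     is_continuous_representation rho -> admissible rho ->
     acts_trivially rho [set: G]).
Proof.
have G0_trivial (V : vectType R) (rho : G -> 'End(V)) :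
    is_continuous_representation rho -> admissible rho ->
    acts_trivially rho (identity_component G).
  move=> rhoP [d [B [f [basisB cf naf eqf]]]].
  exact: (rep_identity_component_trivial rhoP basisB cf naf eqf).
split=> // G_connected V rho rhoP rho_adm.
by rewrite -(connected_component_id (x := 1%g) _ G_connected) //; exact: G0_trivial.
Qed.
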